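(* For every integer $n\geq 45$, \[ ex(n,K_4,B_{4,1})=\left\lfloor\frac{(n-2)^2}{4}\right\rfloor, \] and, up to isomorphism, $K_2\vee T_2(n-2)$ is the unique $B_{4,1}$-free graph on $n$ vertices containing exactly $\lfloor (n-2)^2/4\rfloor$ copies of $K_4$.
   Context: For integers $0\le s<r$, $B_{r,s}$ denotes the graph consisting of two copies of $K_r$ that share exactly $s$ vertices. A graph is $F$-free if it contains no subgraph isomorphic to $F$. For graphs $T,F$, $ex(n,T,F)$ denotes the maximum number of copies of $T$ in an $F$-free graph on $n$ vertices. $T_r(m)$ denotes the $r$-partite Turán graph on $m$ vertices, i.e. the complete $r$-partite graph on $m$ vertices whose part sizes differ by at most one. The join $G_1\vee G_2$ is the disjoint union of $G_1$ and $G_2$ together with all edges between $V(G_1)$ and $V(G_2)$. *)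

(* Defs.v *)
From HB Require Import structures.
From mathcomp Require Import all_boot.

Set Implicit Arguments.
Unset Strict Implicit.
Unset Printing Implicit Defensive.

Section SimpleGraphs.
Variable V : finType.

Record sgraph := SGraph {
  edges : {set {set V}};
  edgesP : [forall e in edges, #|e| == 2]
}.

HB.instance Definition _ := [isSub for edges].
HB.instance Definition _ := [Finite of sgraph by <:].

Definition adj (G : sgraph) : rel V := fun x y => [set x; y] \in edges G.

Definition rel_edges (e : rel V) : {set {set V}} :=
  [set [set x; y] | x in V, y in V & (x != y) && e x y].

Fact rel_edgesP (e : rel V) : [forall f in rel_edges e, #|f| == 2].
Proof.
apply/forall_inP => _ /imset2P[x y _ /[!inE] /andP[_ /andP[nxy _]] ->].
by rewrite cards2 nxy.
Qed.

Definition sgraph_of (e : rel V) : sgraph := SGraph (rel_edgesP e).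

Lemma sgraph_ofE (e : rel V) (x y : V) :
  adj (sgraph_of e) x y = (x != y) && (e x y || e y x).
Proof.
rewrite /adj /=; apply/imset2P/andP.
- case=> a b _ /[!inE] /andP[_ /andP[nab eab]] /setP E.
  have /[!inE] := E a; have /[!inE] := E b; have /[!inE] := E x.
  have /[!inE] := E y; rewrite !eqxx ?orbT /=.
  move=> /esym/orP yab /esym/orP xab bxy axy.
  case: xab yab => /eqP ? [] /eqP ?; subst x y => //.
  + by move: bxy; rewrite eq_sym (negbTE nab).
  + by rewrite nab eab.
  + by rewrite eq_sym nab eab orbT.
  + by move: axy; rewrite (negbTE nab).
- case=> nxy /orP[exy|eyx]; first by exists x y; rewrite ?inE ?nxy.
  by exists y x; rewrite ?inE ?[y == x]eq_sym ?nxy // setUC.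
Qed.

End SimpleGraphs.

Definition iso (U V : finType) (G : sgraph U) (H : sgraph V) : Prop :=
  exists2 f : U -> V, bijective f &
    edges H = [set f @: e | e : {set U} in edges G].

(* A subgraph of G is a pair (W, E) of a vertex set and an edge set; a copy of
   T in G is a (not necessarily induced) subgraph of G isomorphic to T. *)
Definition copies (U V : finType) (T : sgraph U) (G : sgraph V) :
    {set {set V} * {set {set V}}} :=
  [set H : {set V} * {set {set V}} | (H.2 \subset edges G) &&
     [exists f : {ffun U -> V}, [&& injectiveb f,
        H.1 == f @: U & H.2 == [set f @: e | e : {set U} in edges T]]]].

Definition is_free (U V : finType) (F : sgraph U) (G : sgraph V) : bool :=
  copies F G == set0.

Definition ex (n : nat) (U W : finType) (T : sgraph U) (F : sgraph W) : nat :=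
  \max_(G : sgraph 'I_n | is_free F G) #|copies T G|.

Definition complete_graph (r : nat) : sgraph 'I_r :=
  sgraph_of (fun _ _ => true).

(* B_{r,s} for s < r: the two cliques are {0, ..., r - 1} and
   {r - s, ..., 2r - s - 1}, whose intersection has s elements. *)
Definition two_cliques (r s : nat) : sgraph 'I_(2 * r - s) :=
  sgraph_of (fun i j : 'I_(2 * r - s) =>
    (i < r) && (j < r) || (r - s <= i) && (r - s <= j)).

(* The parts are the residue classes modulo r, so their sizes differ by at
   most one. *)
Definition turan (r m : nat) : sgraph 'I_m :=
  sgraph_of (fun i j : 'I_m => i != j %[mod r]).

Definition join (U V : finType) (G : sgraph U) (H : sgraph V) :
    sgraph (U + V)%type :=
  sgraph_of (fun x y => match x, y with
    | inl a, inl b => adj G a b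
    | inr a, inr b => adj H a b
    | _, _ => true
    end).

(* Main.v *)
Require Import Defs.
From mathcomp Require Import all_boot zify.

Set Implicit Arguments.
Unset Strict Implicit.
Unset Printing Implicit Defensive.

(* A graph is B_{4,1}-free iff its K4s, as vertex sets, never meet in exactly
   one point. Call x, y twins if every K4 contains both or none of them.
   If x, y are twins, the K4s through them form a triangle-free link graph.
   - If all K4s contain the twins x, y, Mantel's theorem with its equality case
     gives the bound floor((n-2)^2/4) and the extremal graph.
   - If a twin pair has a nonempty set W of private vertices (those all of whose
     K4s contain the pair), deleting W destroys at most |W|^2/4 K4s.
   - If no pair has private vertices, the link of a twin pair is a matching, so
     twins have degree at most (n-2)/2; a triple of pairwise non-twins that lies
     in five K4s produces a vertex of degree at most 7, which can be deleted;
     otherwise a vertex without a twin has degree at most 3 * 3 * 4 = 36.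
   Induction gives 4 * #K4 <= max(36 n, (n-2)^2), and for n >= 45 the bound
   is attained only in the first case. *)

(** * Families of 4-sets that never meet in one point *)

Section Families.
Variable V : finType.
Implicit Types (F : {set {set V}}) (A B N P Q R S T W : {set V}).

Definition star F v := [set Q in F | v \in Q].

Lemma sum_star F S : \sum_(v in S) #|star F v| = \sum_(Q in F) #|Q :&: S|.
Proof.
under eq_bigr => v _ do rewrite -sum1_card big_mkcond /=.
rewrite exchange_big /= [RHS]big_mkcond /=; apply: eq_bigr => Q _.
rewrite big_mkcond -sum1_card [in RHS]big_mkcond /=; case: ifP => QF.
  by apply: eq_bigr => v _; rewrite !inE QF andbC; case: (v \in S) (v \in Q) => [] [].
by apply: big1 => v _; rewrite !inE QF /=; case: ifP.
Qed.

(** Each member of [F] is counted at least once in the degree sum over the transversal [S]. *)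
Lemma card_le_transversal F S k :
  (forall Q, Q \in F -> Q :&: S != set0) ->
  (forall v, v \in S -> #|star F v| <= k) -> #|F| <= #|S| * k.
Proof.
move=> hS hk; rewrite -sum_nat_const.
apply: (@leq_trans (\sum_(v in S) #|star F v|)); last exact: leq_sum.
rewrite sum_star -sum1_card; apply: leq_sum => Q QF.
by rewrite card_gt0 hS.
Qed.

(* The last clause, "four vertices pairwise joined inside K4s span a K4", is
   what remains of the ambient graph; unlike the graph itself, it passes to the
   subfamily avoiding a set of vertices without further data. *)
Definition K4_family F :=
  [/\ forall Q, Q \in F -> #|Q| = 4,
      forall P Q, P \in F -> Q \in F -> #|P :&: Q| <> 1 &
      forall T, #|T| = 4 ->
        (forall u v, u \in T -> v \in T -> u != v ->
           exists Q, [/\ Q \in F, u \in Q & v \in Q]) -> T \in F].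

Definition avoiding F S := [set Q in F | Q :&: S == set0].

Lemma K4_family_avoiding F S : K4_family F -> K4_family (avoiding F S).
Proof.
case=> h4 h1 hc; split=> [Q /[!inE]/andP[/h4]|P Q /[!inE]/andP[PF _]/andP[QF _]|T T4 cT] //.
  exact: h1.
rewrite !inE hc //=; last first.
  by move=> u v uT vT /(cT u v uT vT)[Q [/[!inE]/andP[QF _] uQ vQ]]; exists Q.
(* A vertex [u] of [T] shares a member of the subfamily with another vertex of [T], and that member
   misses [S]. *)
apply/eqP/setP=> u; rewrite !inE; apply/negP=> /andP[uT uS].
have [v] : exists v, v \in T :\ u.
  by apply/set0Pn; rewrite -card_gt0; have := cardsD1 u T; rewrite uT T4; lia.
rewrite !inE eq_sym => /andP[nuv vT].
have [Q [/[!inE]/andP[_ /eqP/setP/(_ u)]]] := cT u v uT vT nuv.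
by rewrite !inE uS andbT => ->.
Qed.

Lemma card_avoiding F S :
  #|F| = #|avoiding F S| + #|[set Q in F | Q :&: S != set0]|.
Proof.
rewrite -(cardsID (avoiding F S) F); congr addn; apply: eq_card=> Q; rewrite !inE.
  by case: (Q \in F).
by case: (Q \in F); rewrite ?andbT ?andbF.
Qed.

Lemma meet2 F P Q v : K4_family F -> P \in F -> Q \in F -> v \in P -> v \in Q ->
  exists u, [/\ u != v, u \in P & u \in Q].
Proof.
case=> _ h1 _ PF QF vP vQ; have := h1 _ _ PF QF.
rewrite (cardsD1 v) inE vP vQ /= => h.
have /set0Pn[u] : (P :&: Q) :\ v != set0 by rewrite -card_gt0; lia.
by rewrite !inE => /and3P[]; exists u.
Qed.

(** * Twin pairs and their link graphs *)

(** The middle clause keeps two vertices that lie in no member from being twins vacuously. *)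
Definition twin F x y :=
  [&& x != y, [exists Q in F, x \in Q] & [forall Q in F, (x \in Q) == (y \in Q)]].

Lemma twinP F x y : reflect
  [/\ x != y, exists2 Q, Q \in F & x \in Q & forall Q, Q \in F -> (x \in Q) = (y \in Q)]
  (twin F x y).
Proof.
apply: (iffP and3P) => -[? /exists_inP ? h]; split=> //.
  by move=> Q QF; apply/eqP; move/forall_inP: h; apply.
by apply/forall_inP => Q QF; apply/eqP/h.
Qed.

Lemma card_set4 (x y a b : V) : uniq [:: x; y; a; b] -> #|[set x; y; a; b]| = 4.
Proof.
move=> U; have -> : [set x; y; a; b] = [set:: [:: x; y; a; b]].
  by apply/setP=> u; rewrite !inE !orbA.
by rewrite cardsE; apply/card_uniqP.
Qed.

Lemma set4P (x y a b : V) Q : #|Q| = 4 -> uniq [:: x; y; a; b] ->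
  x \in Q -> y \in Q -> a \in Q -> b \in Q -> Q = [set x; y; a; b].
Proof.
move=> Q4 U xQ yQ aQ bQ; apply/esym/eqP; rewrite eqEcard Q4.
apply/andP; split.
  by apply/subsetP=> u; rewrite !inE -!orbA => /or4P[]/eqP->.
by rewrite card_set4.
Qed.

(* Otherwise [x], [a], [b], [c] would span a K4 that contains [x] but not its twin. *)
Lemma twin_no_triangle F x y a b c : K4_family F -> twin F x y ->
  uniq [:: x; y; a; b; c] ->
  (forall u v, u \in [set a; b; c] -> v \in [set a; b; c] -> u != v ->
     exists Q, [/\ Q \in F, u \in Q & v \in Q]) ->
  (forall u, u \in [set a; b; c] -> exists Q, [/\ Q \in F, x \in Q & u \in Q]) -> False.
Proof.
case=> h4 h1 hc /twinP[nxy _ tw] U cp cx.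
have TF : [set x; a; b; c] \in F.
  apply: hc => [|u v].
    apply: card_set4; move: U; rewrite /= !inE; case: (x == y) => //=.
    by case/and5P=> -> _ -> ->.
  have setE w : w \in [set x; a; b; c] = (w == x) || (w \in [set a; b; c]).
    by rewrite !inE -!orbA.
  rewrite !setE => /orP[/eqP->|uT] /orP[/eqP->|vT]; rewrite ?eqxx //.
  - by move=> _; have [Q [? ? ?]] := cx _ vT; exists Q.
  - by move=> _; have [Q [? ? ?]] := cx _ uT; exists Q.
  - exact: cp.
have := tw _ TF; rewrite !inE eqxx /= => /esym.
move: U; rewrite /= !inE ![y == _]eq_sym.
by case: (x == y); case: (a == y); case: (b == y); case: (c == y); rewrite ?andbF ?orbT.
Qed.

Lemma uniq4E (x y a b : V) : uniq [:: x; y; a; b] ->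
  [/\ [/\ x != y, x != a & x != b], y != a, y != b & a != b].
Proof. by rewrite /= !inE !negb_or => /and4P[/and3P[-> -> ->] /andP[-> ->] ->]. Qed.

Lemma set4_fourth (x y z : V) Q : #|Q| = 4 -> uniq [:: x; y; z] ->
  x \in Q -> y \in Q -> z \in Q ->
  exists t, uniq [:: x; y; z; t] /\ Q = [set x; y; z; t].
Proof.
move=> Q4 U xQ yQ zQ.
have [t] : exists t, t \in Q :\: [set:: [:: x; y; z]].
  apply/set0Pn; rewrite -card_gt0; have := cardsID [set:: [:: x; y; z]] Q.
  have : #|Q :&: [set:: [:: x; y; z]]| <= 3; last by lia.
  by apply: leq_trans (subset_leq_card (subsetIr _ _)) _; rewrite cardsE card_size.
rewrite 2!inE => /andP[nt tQ].
have U4 : uniq [:: x; y; z; t] by rewrite (rcons_uniq [:: x; y; z]) nt.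
by exists t; split=> //; apply: set4P.
Qed.

Lemma set4_pair (x y : V) Q : #|Q| = 4 -> x != y -> x \in Q -> y \in Q ->
  exists a b, uniq [:: x; y; a; b] /\ Q = [set x; y; a; b].
Proof.
move=> Q4 nxy xQ yQ.
have [z] : exists z, z \in Q :\: [set x; y].
  apply/set0Pn; rewrite -card_gt0; have := cardsID [set x; y] Q.
  have := subset_leq_card (subsetIr Q [set x; y]); rewrite cards2 nxy; lia.
rewrite !inE => /andP[nz zQ]; exists z.
apply: set4_fourth => //=; rewrite !inE !negb_or nxy ![_ == z]eq_sym.
by move: nz; rewrite negb_or andbT.
Qed.

(* Mantel's argument: [N] is the link of a vertex [v] of maximum degree in the
   graph of pairs [ab] with [xyab] in [F1]; since [N] is independent, its
   complement meets every edge. *)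
Lemma book_mantel F F1 x y W : K4_family F -> twin F x y -> F1 \subset F ->
  x \notin W -> y \notin W ->
  (forall Q, Q \in F1 -> x \in Q /\ Q \subset [set x; y] :|: W) ->
  exists N, [/\ N \subset W,
    forall Q, Q \in F1 -> Q :&: (W :\: N) != set0 &
    \sum_(Q in F1) #|Q :&: (W :\: N)| <= #|N| * #|W :\: N| ].
Proof.
move=> KF tw /subsetP sF xW yW hQ; have [h4 _ _] := KF.
have [nxy _ twxy] := twinP _ _ _ tw.
have decomp Q : Q \in F1 -> exists a b,
    [/\ uniq [:: x; y; a; b], Q = [set x; y; a; b], a \in W & b \in W].
  move=> QF1; have [xQ QW] := hQ _ QF1; have QF := sF _ QF1.
  have [a [b [U eQ]]] := set4_pair (h4 _ QF) nxy xQ (etrans (esym (twxy _ QF)) xQ).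
  exists a, b; split=> //.
    have := subsetP QW a; rewrite eQ !inE eqxx !orbT => /(_ isT).
    by have [[_ /negbTE+ _] /negbTE+ _ _] := uniq4E U; rewrite ![_ == a]eq_sym => -> ->.
  have := subsetP QW b; rewrite eQ !inE eqxx !orbT => /(_ isT).
  by have [[_ _ /negbTE+] _ /negbTE+ _] := uniq4E U; rewrite ![_ == b]eq_sym => -> ->.
have [->|[Q0 Q0F]] := set_0Vmem F1.
  by exists set0; split; rewrite ?sub0set ?big_set0 // => Q; rewrite inE.
have [v0 [_ [_ _ v0W _]]] := decomp _ Q0F.
case: (arg_maxnP (fun v => #|star F1 v|) v0W) => v vW vmax.
have [nvx nvy] : x != v /\ y != v.
  by split; [apply: contraNneq xW|apply: contraNneq yW] => ->.
pose N := [set u in W | (u != v) && ([set x; y; v; u] \in F1)].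
have dN : #|star F1 v| <= #|N|.
  apply: leq_trans (leq_imset_card (fun u => [set x; y; v; u]) N).
  apply/subset_leq_card/subsetP => Q; rewrite inE => /andP[QF1 vQ].
  have [xQ QW] := hQ _ QF1; have QF := sF _ QF1.
  have yQ := etrans (esym (twxy _ QF)) xQ.
  have U3 : uniq [:: x; y; v] by rewrite /= !inE negb_or nxy nvx nvy.
  have [u [U eQ]] := set4_fourth (h4 _ QF) U3 xQ yQ vQ.
  apply/imsetP; exists u => //; rewrite !inE -eQ QF1 andbT.
  have := subsetP QW u; rewrite eQ !inE eqxx !orbT => /(_ isT).
  have [[_ _ /negbTE+] _ /negbTE+ nvu] := uniq4E U.
  by rewrite ![_ == u]eq_sym => -> -> /= ->; rewrite eq_sym nvu.
exists N; split.
- by apply/subsetP => u; rewrite inE => /andP[].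
- move=> Q QF1; apply/negP => /eqP/setP QB0.
  have [a [b [U eQ aW bW]]] := decomp _ QF1.
  have [xQ _] := hQ _ QF1.
  have aN : a \in N.
    have := QB0 a; rewrite in_set0 in_setI in_setD aW eQ !inE eqxx ?orbT /= andbT.
    by move/negbFE.
  have bN : b \in N.
    have := QB0 b; rewrite in_set0 in_setI in_setD bW eQ !inE eqxx ?orbT /= andbT.
    by move/negbFE.
  move: aN bN; rewrite !inE aW bW /= => /andP[nav aF] /andP[nbv bF].
  (* Both [a] and [b] are linked to [v], and [Q] links them to each other: [v], [a], [b] would be a
     triangle in the link of the twins. *)
  apply: (@twin_no_triangle F x y v a b) => //.
  + move: U; rewrite /= !inE !negb_or nxy nvx nvy [v == a]eq_sym nav [v == b]eq_sym nbv /= !andbT.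
    by case/and3P=> /andP[-> ->] /andP[-> ->] ->.
  + have sva : exists Q', [/\ Q' \in F, v \in Q' & a \in Q'].
      by exists [set x; y; v; a]; rewrite !inE !eqxx ?orbT; split=> //; apply: sF.
    have svb : exists Q', [/\ Q' \in F, v \in Q' & b \in Q'].
      by exists [set x; y; v; b]; rewrite !inE !eqxx ?orbT; split=> //; apply: sF.
    have sab : exists Q', [/\ Q' \in F, a \in Q' & b \in Q'].
      by exists Q; rewrite eQ !inE !eqxx ?orbT; split=> //; rewrite -eQ; apply: sF.
    have sym u w : (exists Q', [/\ Q' \in F, u \in Q' & w \in Q']) ->
       exists Q', [/\ Q' \in F, w \in Q' & u \in Q'] by case=> Q' []; exists Q'.
    move=> u w; rewrite !inE -!orbA => /or3P[]/eqP-> /or3P[]/eqP->; rewrite ?eqxx //= => _;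
      by [|apply: sym].
  + move=> u; rewrite !inE -orbA => /or3P[]/eqP->.
    * by exists [set x; y; v; a]; rewrite !inE !eqxx ?orbT; split=> //; apply: sF.
    * by exists Q; rewrite eQ !inE !eqxx ?orbT; split=> //; rewrite -eQ; apply: sF.
    * by exists Q; rewrite eQ !inE !eqxx ?orbT; split=> //; rewrite -eQ; apply: sF.
- rewrite -sum_star mulnC -sum_nat_const; apply: leq_sum => u /[!inE]/andP[_ uW].
  exact: leq_trans (vmax _ uW) dN.
Qed.

(** The transversal [W :\: N] bounds [#|F1|] by [#|N| * #|W :\: N|], a product of two numbers with
    sum [#|W|]; the AM-GM inequality finishes. *)
Lemma card_book F F1 x y W : K4_family F -> twin F x y -> F1 \subset F ->
  x \notin W -> y \notin W ->
  (forall Q, Q \in F1 -> x \in Q /\ Q \subset [set x; y] :|: W) ->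
  4 * #|F1| <= #|W| ^ 2.
Proof.
move=> KF tw sF xW yW hQ.
have [N [NW tN sN]] := book_mantel KF tw sF xW yW hQ.
have : #|F1| <= #|N| * #|W :\: N|.
  apply: leq_trans sN; rewrite -sum1_card; apply: leq_sum => Q /tN.
  by rewrite -card_gt0.
have := cardsID N W; rewrite (setIidPr NW) => <- le1.
by apply: leq_trans (nat_AGM2 _ _); rewrite leq_mul2l.
Qed.

(** Equality case of Mantel's theorem: [#|F|], the sum of the [#|Q :&: B|] and [#|N| * #|B|]
    coincide, so every member meets the transversal [B] exactly once and has its fourth vertex in
    [N]. *)
Lemma max_book F x y : K4_family F -> twin F x y ->
  (forall Q, Q \in F -> x \in Q) -> #|F| = (#|V| - 2) ^ 2 %/ 4 ->
  exists N B, [/\ [/\ x \notin N :|: B, y \notin N :|: B, N :&: B = set0 &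
     [set x; y] :|: (N :|: B) = setT],
     #|N| * #|B| = (#|V| - 2) ^ 2 %/ 4 &
     F = [set [set x; y; a; b] | a in N, b in B]].
Proof.
move=> KF tw xF cF; have [h4 _ _] := KF.
have [nxy _ twxy] := twinP _ _ _ tw.
pose W := ~: [set x; y].
have WE u : (u \in W) = (u != x) && (u != y) by rewrite !inE negb_or.
have cW : #|W| = #|V| - 2 by have := cardsC [set x; y]; rewrite cards2 nxy -/W; lia.
have xW : x \notin W by rewrite WE eqxx.
have yW : y \notin W by rewrite WE eqxx andbF.
have hQ Q : Q \in F -> x \in Q /\ Q \subset [set x; y] :|: W.
  by move=> /xF xQ; rewrite setUCr subsetT.
have [N [NW tN sN]] := book_mantel KF tw (subxx _) xW yW hQ.
set B := W :\: N in tN sN.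
have NB : N :|: B = W.
  by rewrite /B -{2}(setID W N) (setIidPr NW).
have card_NB : #|N| + #|B| = #|W| by rewrite -(cardsID N W) (setIidPr NW).
have le1 : #|F| <= \sum_(Q in F) #|Q :&: B|.
  by rewrite -sum1_card; apply: leq_sum => Q /tN; rewrite -card_gt0.
have le2 : #|N| * #|B| <= (#|V| - 2) ^ 2 %/ 4.
  by rewrite leq_divRL // -cW -card_NB mulnC nat_AGM2.
have cNB : #|N| * #|B| = (#|V| - 2) ^ 2 %/ 4.
  by apply/eqP; rewrite eqn_leq le2 -cF (leq_trans le1).
have one Q : Q \in F -> #|Q :&: B| = 1.
  move=> QF; apply/eqP; rewrite eqn_leq card_gt0 tN // andbT.
  have : \sum_(P in F) #|P :&: B| <= #|F| by rewrite cF -cNB.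
  rewrite (bigD1 Q) //= (cardsD1 Q F) QF /=.
  have rest : #|F :\ Q| <= \sum_(i in F | i != Q) #|i :&: B|.
    rewrite -sum1_card (eq_bigl (fun i => (i \in F) && (i != Q))); last first.
      by move=> i; rewrite !inE andbC.
    by apply: leq_sum => P /andP[/tN]; rewrite -card_gt0.
  by move=> /(leq_trans (leq_add (leqnn _) rest)); rewrite leq_add2r.
exists N, B; split=> //.
  split; rewrite ?NB ?WE ?eqxx ?andbF ?setUCr //.
  by apply/setP=> u; rewrite !inE; case: (u \in N).
(* There are at most [#|N| * #|B| = #|F|] sets on the right, so it suffices that they include
   [F]. *)
apply/eqP; rewrite eqEcard; apply/andP; split; last first.
  rewrite cF -cNB curry_imset2X.
  by apply: leq_trans (leq_imset_card _ _) _; rewrite cardsX.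
apply/subsetP => Q QF; have xQ := xF _ QF.
have [a [b [U eQ]]] := set4_pair (h4 _ QF) nxy xQ (etrans (esym (twxy _ QF)) xQ).
have aW : a \in W.
  by have [[_ xa _] ya _ _] := uniq4E U; rewrite WE ![a == _]eq_sym xa.
have bW : b \in W.
  by have [[_ _ xb] _ yb _] := uniq4E U; rewrite WE ![b == _]eq_sym xb.
have [_ _ _ nab] := uniq4E U.
have xB : x \notin B by rewrite inE WE eqxx andbF.
have yB : y \notin B by rewrite inE WE eqxx !andbF.
have inNB u : u \in W -> u \notin B -> u \in N by rewrite -NB inE; case: (u \in N) => //= ->.
have := one _ QF; case aB: (a \in B); case bB: (b \in B).
- have /subset_leq_card : [set a; b] \subset Q :&: B.
    by rewrite subUset !sub1set eQ !inE !eqxx !orbT; move: aB bB; rewrite !inE => -> ->.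
  by rewrite cards2 nab => + E; rewrite E.
- move=> _; apply/imset2P; exists b a => //; first by rewrite inNB // bB.
  by rewrite eQ -!setUA [[set a] :|: _]setUC.
- by move=> _; apply/imset2P; exists a b => //; rewrite inNB // aB.
- have -> : Q :&: B = set0; last by rewrite cards0.
  apply/setP=> u; rewrite in_set0 in_setI eQ; apply/negP=> /andP[].
  rewrite 3!in_setU 4!in_set1 -!orbA.
  by case/or4P=> /eqP->; rewrite ?(negbTE xB) ?(negbTE yB) ?aB ?bB.
Qed.

(** The member [P] avoids the twins, so its second common vertex with a K4 [[set x; y; u; w]] can
    only be [w]. Two different choices [b], [c] of [w] would lie in [P] with [u] and give a
    forbidden triangle in the link of the twins. *)
Lemma twin_link_matching F x y u P Q Q' : K4_family F -> twin F x y ->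
  u != x -> u != y -> P \in F -> u \in P -> x \notin P ->
  Q \in F -> x \in Q -> u \in Q -> Q' \in F -> x \in Q' -> u \in Q' -> Q = Q'.
Proof.
move=> KF tw nux nuy PF uP xP QF xQ uQ QF' xQ' uQ'; have [h4 _ _] := KF.
have [nxy _ twxy] := twinP _ _ _ tw.
have yP : y \notin P by rewrite -twxy.
have U3 : uniq [:: x; y; u] by rewrite /= !inE negb_or nxy ![_ == u]eq_sym nux nuy.
have [b [Ub eQ]] := set4_fourth (h4 _ QF) U3 xQ (etrans (esym (twxy _ QF)) xQ) uQ.
have [c [Uc eQ']] := set4_fourth (h4 _ QF') U3 xQ' (etrans (esym (twxy _ QF')) xQ') uQ'.
have inP w R : R \in F -> R = [set x; y; u; w] -> w \in P.
  move=> RF eR; have [|v [nvu vP]] := meet2 KF PF RF uP.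
    by rewrite eR !inE eqxx !orbT.
  rewrite eR !inE (negbTE nvu) orbF -orbA => /or3P[]/eqP ev; last by rewrite -ev.
    by rewrite -ev vP in xP.
  by rewrite -ev vP in yP.
have bP := inP b Q QF eQ; have cP := inP c Q' QF' eQ'.
have [eq_bc|nbc] := eqVneq b c; first by rewrite eQ eQ' eq_bc.
exfalso; apply: (@twin_no_triangle F x y u b c) => //.
- move: Ub Uc; rewrite /= !inE !negb_or nbc !andbT.
  by do ![case/andP|move=> ?]; rewrite nxy; do ![apply/andP; split].
- have inT v : v \in [set u; b; c] -> v \in P by rewrite !inE -orbA => /or3P[]/eqP->.
  by move=> v w /inT vP /inT wP _; exists P.
- move=> v; rewrite !inE -orbA => /or3P[]/eqP->; [exists Q|exists Q|exists Q']; split=> //.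
    by rewrite eQ !inE eqxx !orbT.
  by rewrite eQ' !inE eqxx !orbT.
Qed.

(** * Codegrees of triples and degrees of vertices without a twin *)

Lemma card_setD_eq S T : T \subset S -> #|S :\: T| = #|S| - #|T|.
Proof. by move=> TS; rewrite cardsD (setIidPr TS). Qed.

Lemma cardsD1_in v S : v \in S -> #|S :\ v| = #|S|.-1.
Proof. by move=> vS; rewrite (cardsD1 v S) vS. Qed.

Lemma not_twin_split F u w Q : u != w -> ~~ twin F u w -> Q \in F -> u \in Q ->
  exists2 R, R \in F & (u \in R) = ~~ (w \in R).
Proof.
move=> nuw ntw QF uQ.
have [/exists_inP[R RF /eqP ?]|/exists_inPn h] :=
  boolP [exists R in F, (u \in R) == ~~ (w \in R)]; first by exists R.
case/negP: ntw; apply/twinP; split=> //; first by exists Q.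
by move=> R /h; case: (u \in R); case: (w \in R).
Qed.

(* A triple [T] in five members of [F] is met by every member in 0, 2 or 3 points. *)
Lemma codegree_le4 F T : K4_family F -> #|T| = 3 ->
  (forall u w, u \in T -> w \in T -> u != w -> ~~ twin F u w) ->
  (forall Q v, Q \in F -> v \in Q -> 7 < #|star F v|) ->
  #|[set Q in F | T \subset Q]| <= 4.
Proof.
move=> KF T3 ntw dF; have [h4 h1 _] := KF.
rewrite leqNgt; apply/negP; set FT := [set Q in F | _] => cFT.
(* [X] collects the fourth vertices of the members through [T]; the aim is a vertex [b] of [X] with
   degree at most 7, against [dF]. *)
pose X := [set b | (b \notin T) && (b |: T \in F)].
have cX : 4 < #|X|.
  apply: leq_trans cFT (leq_trans _ (leq_imset_card (fun b => b |: T) X)).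
  apply/subset_leq_card/subsetP => Q; rewrite inE => /andP[QF TQ].
  have /cards1P[b eb] : #|Q :\: T| == 1 by rewrite card_setD_eq // h4 // T3.
  have eQ : Q = b |: T by rewrite -eb -{1}(setID Q T) (setIidPr TQ) setUC.
  apply/imsetP; exists b => //; rewrite inE -eQ QF andbT.
  by have : b \in Q :\: T; [rewrite eb inE | rewrite inE => /andP[]].
have cap Q b : b \in Q -> b \notin T -> #|Q :&: (b |: T)| = #|Q :&: T|.+1.
  move=> bQ bT; have -> : Q :&: (b |: T) = b |: (Q :&: T).
    by rewrite setIUr (setIidPr _) ?sub1set.
  by rewrite cardsU1 inE (negbTE bT) andbF.
(* Such a [Q] would share a second point with every [b |: T], necessarily [b], and so contain all of
   [X], which has at least five points. *)
have T1 Q : Q \in F -> #|Q :&: T| <> 1.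
  move=> QF QT1; have : X \subset Q; last first.
    by move/subset_leq_card; rewrite (h4 _ QF); lia.
  apply/subsetP => b; rewrite inE => /andP[bT bF].
  have [//|bQ] := boolP (b \in Q); case: (h1 _ _ QF bF).
  rewrite -QT1; apply: eq_card => u; rewrite !inE.
  by case: eqVneq => // ->; rewrite (negbTE bQ).
have T2 Q b : b \in X -> Q \in F -> b \in Q -> 1 < #|Q :&: T|.
  rewrite inE => /andP[bT bF] QF bQ; have := h1 _ _ QF bF.
  by rewrite cap //; have := T1 _ QF; lia.
have [Q0 Q0F TQ0] : exists2 Q0, Q0 \in F & T \subset Q0.
  have /set0Pn[Q0] : FT != set0 by rewrite -card_gt0; lia.
  by rewrite inE => /andP[]; exists Q0.
(* A member separating [u] from [w] meets [T] without containing it, hence in exactly two points;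
   [m] is the missed one. *)
have split u w : u \in T -> w \in T -> u != w -> exists R m,
    [/\ R \in F, m \in [set u; w], m \notin R, T :\ m \subset R & #|R :\: T| = 2].
  move=> uT wT nuw.
  have [R RF ER] := not_twin_split nuw (ntw _ _ uT wT nuw) Q0F (subsetP TQ0 _ uT).
  have mk m : m \in T -> m \notin R -> 0 < #|R :&: T| ->
      T :\ m \subset R /\ #|R :\: T| = 2.
    move=> mT mR R0; have RTm : R :&: T \subset T :\ m.
      apply/subsetP => k; rewrite !inE => /andP[kR ->]; rewrite andbT.
      by apply: contraNneq mR => <-.
    have cTm : #|T :\ m| = 2 by rewrite cardsD1_in // T3.
    have le := subset_leq_card RTm; have := T1 _ RF => n1.
    have c2 : #|R :&: T| = 2 by clear -le n1 R0 cTm; lia.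
    split; last by have := cardsID T R; rewrite (h4 _ RF) c2 => -[].
    have/eqP <- : R :&: T == T :\ m by rewrite eqEcard RTm c2 cTm.
    exact: subsetIl.
  case uR: (u \in R) ER => /esym ER.
    have [//|//||s c] := mk w.
      by rewrite card_gt0; apply/set0Pn; exists u; rewrite inE uR.
    by exists R, w; rewrite !inE eqxx orbT.
  have [//|||s c] := mk u; first exact: negbT.
    rewrite card_gt0; apply/set0Pn; exists w; rewrite inE wT andbT.
    exact: negbFE.
  by exists R, u; rewrite !inE eqxx uR.
have two S : 1 < #|S| -> exists u w, [/\ u \in S, w \in S & u != w].
  by case/card_gt1P => u [w []]; exists u, w.
have [u0 [w0 [uT wT nuw]]] : exists u w, [/\ u \in T, w \in T & u != w].
  by apply: two; rewrite T3.
have [R1 [m1 [R1F m1uw m1R s1 c1]]] := split _ _ uT wT nuw.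
have m1T : m1 \in T by move: m1uw; rewrite !inE => /orP[]/eqP->.
have c2T m : m \in T -> #|T :\ m| = 2 by move=> mT; rewrite cardsD1_in // T3.
(* Separating the two points of [T] other than [m1] yields a second missed point [m2], different
   from [m1]. *)
have [u1 [w1 [u1T w1T nuw1]]] : exists u w, [/\ u \in T :\ m1, w \in T :\ m1 & u != w].
  by apply: two; rewrite c2T.
have [R2 [m2 [R2F m2uw m2R s2 c2]]] :=
  split _ _ (subsetP (subsetDl _ _) _ u1T) (subsetP (subsetDl _ _) _ w1T) nuw1.
have : m2 \in T :\ m1 by move: m2uw; rewrite !inE => /orP[]/eqP->; rewrite -in_setD1.
rewrite in_setD1 => /andP[nm21 m2T].
(* [R1] and [R2] have two points each outside [T], so they cannot cover the five points of [X]. *)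
have [b bX bR] : exists2 b, b \in X & b \notin R1 :|: R2.
  have /subsetPn[b bX bn] : ~~ (X \subset (R1 :\: T) :|: (R2 :\: T)).
    apply/negP => /subset_leq_card; have := leq_of_leqif (leq_card_setU (R1 :\: T) (R2 :\: T)).
    by rewrite c1 c2; clear -cX; lia.
  exists b => //; move: bX bn; rewrite !inE => /andP[bT _].
  by rewrite bT.
move: bR; rewrite inE negb_or => /andP[bR1 bR2].
have [bT bTF] : b \notin T /\ b |: T \in F by move: bX; rewrite inE => /andP[].
(* A member through [b] other than [b |: T] misses one point [m] of [T] and equals some [g m c].
   Here [c] lies in [R2] if [m] is [m1], and in [R1] otherwise, which leaves at most 1 + 2 * 2 + 2 =
   7 members. *)
pose g m c := b |: (c |: (T :\ m)).
pose Y1 := [set g m c | m in T :\ m1, c in R1 :\: T].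
pose Y2 := [set g m1 c | c in R2 :\: T].
have starb : star F b \subset (b |: T) |: (Y1 :|: Y2).
  apply/subsetP => Q; rewrite inE => /andP[QF bQ].
  have QT := T2 _ _ bX QF bQ.
  have [TQ|/subsetPn[m mT mQ]] := boolP (T \subset Q).
    rewrite !inE; apply/orP; left; apply/eqP/esym/eqP.
    by rewrite eqEcard subUset sub1set bQ TQ h4 // cardsU1 bT T3.
  have QTm : Q :&: T \subset T :\ m.
    apply/subsetP => k; rewrite !inE => /andP[kQ ->]; rewrite andbT.
    by apply: contraNneq mQ => <-.
  have/eqP QTE : Q :&: T == T :\ m by rewrite eqEcard QTm c2T.
  have/cards1P[c ec] : #|(Q :\: T) :\ b| == 1.
    rewrite cardsD1_in ?inE ?bT //.
    by have := cardsID T Q; rewrite (h4 _ QF) QTE c2T // => -[]; rewrite add0n => ->.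
  have : c \in (Q :\: T) :\ b by rewrite ec inE.
  rewrite !inE => /and3P[ncb cT cQ].
  have eQ : Q = g m c.
    apply/esym/eqP; rewrite eqEcard h4 // /g !cardsU1 c2T //.
    rewrite !inE (negbTE bT) (negbTE cT) ![b == _]eq_sym (negbTE ncb) !andbF /= andbT.
    rewrite !subUset !sub1set bQ cQ -QTE; exact: subsetIl.
  (* [Q] and [R] share the third point [k] of [T], hence one more point. It is not [b], which [R]
     avoids, and neither [m] nor [m'], each missed by one of the two sets; only [c] remains. *)
  have cR R m' : R \in F -> m' \in T -> m' \notin R -> T :\ m' \subset R -> b \notin R ->
      m != m' -> c \in R.
    move=> RF mT' mR' sR nbR nmm'.
    have [k] : exists k, k \in (T :\ m) :\ m'.
      apply/set0Pn; rewrite -card_gt0 cardsD1_in ?c2T //.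
      by rewrite !inE mT' eq_sym nmm'.
    rewrite !inE => /and3P[nkm' nkm kT].
    have kQ : k \in Q by rewrite eQ !inE nkm kT !orbT.
    have kR : k \in R by apply: (subsetP sR); rewrite !inE nkm'.
    have [j [njk jQ jR]] := meet2 KF QF RF kQ kR.
    move: jQ; rewrite eQ !inE => /or3P[/eqP ej|/eqP <- //|/andP[njm jT]].
      by rewrite -ej jR in nbR.
    have njm' : j != m' by apply: contraNneq mR' => <-.
    have : [set m; m'; k; j] \subset T.
      by apply/subsetP => i; rewrite !inE -!orbA => /or4P[]/eqP->.
    move/subset_leq_card; rewrite card_set4 ?T3 //= !inE !negb_or nmm'.
    by rewrite ![_ == k]eq_sym nkm nkm' ![_ == j]eq_sym njm njm' njk.
  apply/orP; right; apply/orP.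
  have [em|nm] := eqVneq m m1.
    right; apply/imsetP; exists c; last by rewrite -em.
    by rewrite inE cT (cR R2 m2) // em eq_sym.
  left; apply/imset2P; exists m c => //; first by rewrite !inE nm.
  by rewrite inE cT (cR R1 m1).
have := dF _ _ bTF (setU11 b T).
have := subset_leq_card starb.
have : #|Y1| <= 4.
  rewrite /Y1 curry_imset2X; apply: leq_trans (leq_imset_card _ _) _.
  by rewrite cardsX c2T // c1.
have : #|Y2| <= 2 by rewrite -c2; apply: leq_imset_card.
have := leq_of_leqif (leq_card_setU Y1 Y2).
have := leq_of_leqif (leq_card_setU [set b |: T] (Y1 :|: Y2)).
rewrite cards1 => le_star le_12 le_2 le_1 le_b.
by rewrite ltnNge (leq_trans le_b) // (leq_trans le_star) // add1n ltnS
  (leq_trans le_12) // (leq_add le_1 le_2).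
Qed.

(** The constant is 3 * 3 * 4. Every member through [v] meets [Q0 :\ v] in some [y]. A member [R]
    separating [v] from [y] contains exactly one of them, so all members through both meet [R] in a
    further point [k], with at most three choices; the triple [v], [y], [k] then lies in at most
    four members. *)
Lemma nontwin_degree F v : K4_family F -> (forall y, ~~ twin F v y) ->
  (forall T, v \in T -> #|T| = 3 -> #|[set Q in F | T \subset Q]| <= 4) ->
  #|star F v| <= 36.
Proof.
move=> KF ntw cod; have [h4 h1 _] := KF.
have [->|[Q0 /[!inE]/andP[Q0F vQ0]]] := set_0Vmem (star F v); first by rewrite cards0.
have -> : 36 = #|Q0 :\ v| * 12.
  by rewrite cardsD1_in // (h4 _ Q0F).
apply: card_le_transversal => [Q /[!inE]/andP[QF vQ]|y].
  have [u [nuv uQ uQ0]] := meet2 KF QF Q0F vQ vQ0.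
  by apply/set0Pn; exists u; rewrite !inE nuv uQ.
rewrite !inE => /andP[nyv yQ0].
have nvy : v != y by rewrite eq_sym.
have [R RF ER] := not_twin_split nvy (ntw y) Q0F vQ0.
have [p [pvy pR]] : exists p, p \in [set v; y] /\ p \in R.
  case vR: (v \in R) ER => ER; first by exists v; rewrite !inE eqxx.
  by exists y; rewrite !inE eqxx orbT (negbFE (esym ER)).
have c3 : #|R :\: [set v; y]| <= 3.
  have <- : #|R :\ p| = 3 by rewrite cardsD1_in // (h4 _ RF).
  apply: subset_leq_card.
  by rewrite setDS // sub1set.
apply: (@leq_trans (#|R :\: [set v; y]| * 4)); last by rewrite (leq_mul2r 4 _ 3) c3.
apply: card_le_transversal => [Q /[!inE]/andP[/andP[QF vQ] yQ]|k].
  have pQ : p \in Q by move: pvy; rewrite !inE => /orP[]/eqP->.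
  have [u [nup uQ uR]] := meet2 KF QF RF pQ pR.
  apply/set0Pn; exists u; rewrite !inE uQ uR !andbT negb_or /=.
  move: pvy ER; rewrite !inE => /orP[]/eqP ep; rewrite -ep nup ?andbT /= pR.
    by move=> /esym; apply: contraTneq => <-; rewrite uR.
  by move=> /negbT; apply: contraNneq => <-.
rewrite !inE negb_or => /andP[/andP[nkv nky] kR].
apply: (@leq_trans #|[set Q in F | [set v; y; k] \subset Q]|).
  apply/subset_leq_card/subsetP => Q; rewrite !inE.
  by rewrite !subUset !sub1set -!andbA.
apply: cod; first by rewrite !inE eqxx.
by rewrite -setUA cardsU1 cards2 !inE negb_or nvy ![_ == k]eq_sym nkv nky.
Qed.

(** * Private vertices of a twin pair *)

Lemma twin_sym F x y : twin F x y -> twin F y x.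
Proof.
case/twinP=> nxy [Q QF xQ] tw; apply/twinP; split; first by rewrite eq_sym.
  by exists Q; rewrite -?tw.
by move=> R RF; rewrite tw.
Qed.

(** Membership is tested for [x] alone, since for twins that of [y] follows. *)
Definition private F x y := [set u | [&& u != x, u != y, [exists Q in F, u \in Q]
  & [forall Q in F, (u \in Q) ==> (x \in Q)]]].

Lemma privateP F x y u : reflect
  [/\ u != x, u != y, exists2 Q, Q \in F & u \in Q &
      forall Q, Q \in F -> u \in Q -> x \in Q]
  (u \in private F x y).
Proof.
rewrite inE; apply: (iffP and4P) => -[? ? /exists_inP ? h]; split=> //.
  by move=> Q QF; apply/implyP; move/forall_inP: h; apply.
by apply/forall_inP => Q QF; apply/implyP/h.
Qed.

(** A member [Q] with a private vertex [u] consists of the twins and private vertices, so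
    [card_book] applies: a member through another vertex [k] of [Q] that avoided [x] would have to
    share [u] with [Q], and then contain [x] after all. *)
Lemma card_meet_private F x y : K4_family F -> twin F x y ->
  4 * #|[set Q in F | Q :&: private F x y != set0]| <= #|private F x y| ^ 2.
Proof.
move=> KF tw; have [h4 _ _] := KF; have [nxy _ twxy] := twinP _ _ _ tw.
apply: (card_book KF tw).
- by apply/subsetP => Q /[!inE]/andP[].
- by rewrite inE eqxx.
- by rewrite inE eqxx andbF.
move=> Q; rewrite inE => /andP[QF /set0Pn[u]]; rewrite inE => /andP[uQ uW].
have [nux nuy _ hu] := privateP _ _ _ _ uW.
have xQ := hu _ QF uQ; split=> //.
have yQ : y \in Q by rewrite -twxy.
apply/subsetP => k kQ; rewrite in_setU in_set2.
have [//|nkx] := eqVneq k x; have [//|nky] := eqVneq k y.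
have [->//|nku] := eqVneq k u.
apply/privateP; split=> //; first by exists Q.
move=> P PF kP; have [//|xP] := boolP (x \in P).
have yP : y \notin P by rewrite -twxy.
have [j [njk jP jQ]] := meet2 KF PF QF kP kQ.
have eQ : Q = [set x; y; u; k].
  apply: set4P; rewrite ?h4 //= !inE !negb_or nxy ![_ == u]eq_sym nux nuy.
  by rewrite ![_ == k]eq_sym nkx nky nku.
move: jQ; rewrite eQ !inE (negbTE njk) orbF -orbA => /or3P[]/eqP ej; move: jP; rewrite ej.
- by rewrite (negbTE xP).
- by rewrite (negbTE yP).
- by move/(hu _ PF); rewrite (negbTE xP).
Qed.

(** Each [u] in a member with the twins is not private, so it also lies in a member avoiding them,
    and by [twin_link_matching] only one member contains [x], [y], [u]. Every member through [x] is
    counted for two such [u]. *)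
Lemma twin_degree F A x y : K4_family F -> (forall Q, Q \in F -> Q \subset A) ->
  twin F x y -> private F x y = set0 -> 2 * #|star F x| <= #|A| - 2.
Proof.
move=> KF FA tw W0; have [h4 _ _] := KF; have [nxy [Q0 Q0F xQ0] twxy] := twinP _ _ _ tw.
have yQ0 : y \in Q0 by rewrite -twxy.
have xyA : [set x; y] \subset A.
  by rewrite subUset !sub1set !(subsetP (FA _ Q0F)).
have -> : #|A| - 2 = #|A :\: [set x; y]| by rewrite card_setD_eq // cards2 nxy.
rewrite -[leqRHS]muln1 -sum_nat_const.
apply: (@leq_trans (\sum_(u in A :\: [set x; y]) #|star (star F x) u|)).
  rewrite sum_star mulnC -sum_nat_const; apply: leq_sum => Q /[!inE]/andP[QF xQ].
  have xyQ : [set x; y] \subset Q by rewrite subUset !sub1set -twxy ?xQ.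
  by rewrite setIDA (setIidPl (FA _ QF)) card_setD_eq // (h4 _ QF) cards2 nxy.
apply: leq_sum => u; rewrite !inE negb_or => /andP[/andP[nux nuy] uA].
apply/card_le1_eqP => Q Q' /[!inE]/andP[/andP[QF xQ] uQ] /andP[/andP[QF' xQ'] uQ'].
have : u \notin private F x y by rewrite W0 inE.
rewrite inE nux nuy /=; have -> /= : [exists R in F, u \in R] by apply/exists_inP; exists Q.
case/forall_inPn => P PF; rewrite negb_imply => /andP[uP xP].
exact: (twin_link_matching KF tw nux nuy PF uP xP).
Qed.

(** * Case distinction and induction on the vertex set *)

(** One case distinction serves both the upper bound and the case of equality. The first and third
    alternatives allow a deletion, the second is the book, and the last sums a bound on all degrees,
    which counts each member four times. *)
Lemma K4_family_cases F A : K4_family F -> (forall Q, Q \in F -> Q \subset A) ->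
  [\/ exists2 v, v \in A & #|star F v| <= 7,
      exists x y, twin F x y /\ forall Q, Q \in F -> x \in Q,
      exists S, [/\ S \subset A, 0 < #|S|, #|S| + 6 <= #|A| &
                    4 * #|[set Q in F | Q :&: S != set0]| <= #|S| ^ 2] |
      4 * #|F| <= #|A| * maxn 36 ((#|A| - 2) %/ 2)].
Proof.
move=> KF FA; have [h4 _ _] := KF.
have [/exists_inP[v]|/exists_inPn h1] := boolP [exists v in A, #|star F v| <= 7].
  by constructor 1; exists v.
have [/existsP[x /existsP[y /andP[tw /forall_inP h]]]|/existsPn h2] :=
  boolP [exists x, exists y, twin F x y && [forall Q in F, x \in Q]].
  by constructor 2; exists x, y.
have [/existsP[x /existsP[y /andP[tw W0]]]|/existsPn h3] :=
  boolP [exists x, exists y, twin F x y && (private F x y != set0)].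
  constructor 3; exists (private F x y); split; last exact: card_meet_private.
  - apply/subsetP => u /privateP[_ _ [Q QF uQ] _]; exact: subsetP (FA _ QF) _ uQ.
  - by rewrite card_gt0.
  have [nxy [Q1 Q1F xQ1] twxy] := twinP _ _ _ tw.
  have /forall_inPn[Q0 Q0F xQ0] : ~~ [forall Q in F, x \in Q].
    by have /existsPn/(_ y) := h2 x; rewrite tw.
  have yQ0 : y \notin Q0 by rewrite -twxy.
  (* The member [Q0] avoids the twins and so has no private vertex; its four vertices and the twins
     are six vertices of [A] outside the private set. *)
  have -> : 6 = #|Q0 :|: [set x; y]|.
    rewrite setUC -setUA !cardsU1 h4 // !inE negb_or nxy xQ0 yQ0 //.
  have disj : private F x y :&: (Q0 :|: [set x; y]) = set0.
    apply/setP => u; rewrite in_set0 in_setI; apply/negP => /andP[/privateP[nux nuy _ hu]].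
    rewrite !inE (negbTE nux) (negbTE nuy) !orbF => uQ0.
    by rewrite (hu _ Q0F uQ0) in xQ0.
  rewrite -[leqLHS]subn0 -(@cards0 V) -disj -cardsU; apply: subset_leq_card.
  rewrite !subUset !sub1set (FA _ Q0F) (subsetP (FA _ Q1F) _ xQ1).
  rewrite (subsetP (FA _ Q1F) y) -?twxy // !andbT.
  by apply/subsetP => u /privateP[_ _ [Q QF uQ] _]; exact: subsetP (FA _ QF) _ uQ.
have priv0 x y : twin F x y -> private F x y = set0.
  by move=> tw; have /existsPn/(_ y) := h3 x; rewrite tw negbK => /eqP.
constructor 4.
have -> : 4 * #|F| = \sum_(v in A) #|star F v|.
  rewrite sum_star mulnC -sum_nat_const; apply: eq_bigr => Q QF.
  by rewrite (setIidPl (FA _ QF)) h4.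
rewrite -sum_nat_const; apply: leq_sum => v vA; rewrite leq_max.
have [/existsP[y tw]|/existsPn ntw] := boolP [exists y, twin F v y].
  by rewrite leq_divRL // mulnC (twin_degree KF FA tw (priv0 _ _ tw)) orbT.
rewrite (nontwin_degree KF ntw) // => T vT T3.
have [/exists_inP[u uT /exists_inP[w wT tw]]|/exists_inPn ntwT] :=
  boolP [exists u in T, exists w in T, twin F u w].
  (* [codegree_le4] does not cover a triple with a twin pair [u], [w]. Here [v] has no twin, so it
     is the third vertex, and as it is not private for the pair, the matching property leaves at
     most one member. *)
  have nvu : v != u by apply: contraTneq tw => <-.
  have nvw : v != w by apply: contraTneq (twin_sym tw) => <-.
  apply: (@leq_trans 1) => //; apply/card_le1_eqP => Q Q'.
  rewrite !inE => /andP[QF /subsetP TQ] /andP[QF' /subsetP TQ'].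
  have : v \notin private F u w by rewrite priv0 // inE.
  rewrite inE nvu nvw /=.
  have -> /= : [exists R in F, v \in R] by apply/exists_inP; exists Q => //; exact: TQ.
  case/forall_inPn => P PF; rewrite negb_imply => /andP[vP uP].
  by apply: (twin_link_matching KF tw nvu nvw PF vP uP); rewrite ?TQ ?TQ'.
apply: codegree_le4 => // [u w uT wT _|Q b QF bQ].
  by have /exists_inPn := ntwT u uT; apply.
by rewrite ltnNge h1 // (subsetP (FA _ QF)).
Qed.

Lemma meet1E F v : [set Q in F | Q :&: [set v] != set0] = star F v.
Proof.
apply/setP=> Q; rewrite !inE; case: (Q \in F) => //=.
by rewrite setI_eq0 disjoint_sym disjoints1 negbK.
Qed.

(** Induction on the size of [A], which shrinks with every deletion. A deleted vertex costs at most
    28 on the left, while the linear bound drops by 36, and the quadratic one by more once it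
    dominates. *)
Lemma card_K4_family F A : K4_family F -> (forall Q, Q \in F -> Q \subset A) ->
  4 * #|F| <= maxn (36 * #|A|) ((#|A| - 2) ^ 2).
Proof.
elim/ltn_ind: {A}#|A| {-2}A (erefl #|A|) F => n IH A cA F KF FA; rewrite cA.
have avoidA S Q : Q \in avoiding F S -> Q \subset A :\: S.
  by rewrite inE => /andP[/FA QA QS]; rewrite subsetD QA -setI_eq0.
case: (K4_family_cases KF FA) => [[v vA dv]|[x [y [tw xF]]]|[S [SA S0 S6 cS]]|].
- have cAv : #|A :\ v| = n.-1 by rewrite cardsD1_in // cA.
  have n0 : 0 < n by rewrite -cA card_gt0; apply/set0Pn; exists v.
  have /IH/(_ _ cAv _ (K4_family_avoiding [set v] KF) (@avoidA [set v])) : n.-1 < n by lia.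
  have := card_avoiding F [set v]; rewrite meet1E cAv.
  by clear -dv n0; nia.
- have [h4 _ _] := KF; have [nxy [Q0 Q0F xQ0] twxy] := twinP _ _ _ tw.
  have xyA : [set x; y] \subset A.
    by rewrite subUset !sub1set !(subsetP (FA _ Q0F)) // -twxy.
  apply: (@leq_trans (#|A :\: [set x; y]| ^ 2)); last first.
    by rewrite card_setD_eq // cards2 nxy cA leq_maxr.
  apply: (card_book KF tw) => //; rewrite ?inE ?eqxx ?orbT // => Q QF; split; first exact: xF.
  apply/subsetP => u uQ; by rewrite !inE (subsetP (FA _ QF)) // andbT orbN.
- have cAS : #|A :\: S| = n - #|S| by rewrite card_setD_eq // cA.
  have /IH/(_ _ cAS _ (K4_family_avoiding S KF) (@avoidA S)) : n - #|S| < n by lia.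
  have := card_avoiding F S; rewrite cAS.
  by rewrite cA in S6; clear -S0 S6 cS; nia.
- rewrite cA; clear; nia.
Qed.

(** From 45 vertices on, every other alternative, with [card_K4_family] applied to what remains
    after a deletion, yields strictly fewer members. *)
Lemma twin_of_large_K4_family F : K4_family F -> 45 <= #|V| ->
  (#|V| - 2) ^ 2 %/ 4 <= #|F| ->
  exists x y, twin F x y /\ forall Q, Q \in F -> x \in Q.
Proof.
move=> KF n45 cF.
have FA Q : Q \in F -> Q \subset [set: V] by move=> _; exact: subsetT.
have avoidA S Q : Q \in avoiding F S -> Q \subset ~: S.
  by rewrite inE => /andP[_]; rewrite setI_eq0 disjoints_subset.
have bound S := card_K4_family (K4_family_avoiding S KF) (@avoidA S).
case: (K4_family_cases KF FA) => [[v _ dv]|//|[S [_ S0 S6 cS]]|].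
- have := bound [set v]; rewrite cardsC1.
  have := card_avoiding F [set v]; rewrite meet1E.
  by clear -dv n45 cF; nia.
- have := bound S; have := card_avoiding F S; have := cardsC S; move: S6; rewrite cardsT.
  by clear -n45 cF S0 cS; nia.
- by rewrite cardsT; clear -n45 cF; nia.
Qed.

End Families.

(** * Copies of K4 in graphs *)

Section Adjacency.
Variable V : finType.
Implicit Types (G : sgraph V) (u v : V).

Lemma adj_sym G u v : adj G u v = adj G v u.
Proof. by rewrite /adj setUC. Qed.

Lemma adj_neq G u v : adj G u v -> u != v.
Proof.
move=> /(forall_inP (edgesP G)); apply: contraTneq => ->.
by rewrite setUid cards1.
Qed.

Lemma edges_set2 G e : e \in edges G -> exists u v, e = [set u; v] /\ adj G u v.
Proof.
move=> eG; have /cards2P[u [v [nuv eE]]] := forall_inP (edgesP G) e eG.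
by exists u, v; rewrite /adj -eE.
Qed.

End Adjacency.

Section Graphs.
Variable V : finType.
Implicit Types (G : sgraph V) (u v : V).

Definition K4s G := [set Q : {set V} | (#|Q| == 4) &&
  [forall u in Q, forall v in Q, (u != v) ==> adj G u v]].

Lemma K4sP G (Q : {set V}) : reflect
  (#|Q| = 4 /\ forall u v, u \in Q -> v \in Q -> u != v -> adj G u v)
  (Q \in K4s G).
Proof.
rewrite inE; apply: (iffP andP) => -[/eqP Q4 h]; split; rewrite ?Q4 //.
  move=> u v uQ vQ; apply/implyP.
  by move: v vQ; apply/forall_inP; move: u uQ; apply/forall_inP.
by apply/forall_inP => u uQ; apply/forall_inP => v vQ; apply/implyP/h.
Qed.

Lemma sub_edgesP (U : finType) (T : sgraph U) G (f : U -> V) :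
  reflect (forall i j, adj T i j -> adj G (f i) (f j))
    ([set f @: e | e : {set U} in edges T] \subset edges G).
Proof.
apply: (iffP subsetP) => h.
  by move=> i j ij; apply: h; apply/imsetP; exists [set i; j]; rewrite // imsetU !imset_set1.
move=> _ /imsetP[e /edges_set2[i [j [-> ij]]] ->].
by rewrite imsetU !imset_set1; apply: h.
Qed.

Lemma copiesP (U : finType) (T : sgraph U) G (H : {set V} * {set {set V}}) :
  reflect (exists f : U -> V, [/\ injective f,
      forall i j, adj T i j -> adj G (f i) (f j), H.1 = f @: U &
      H.2 = [set f @: e | e : {set U} in edges T]])
    (H \in copies T G).
Proof.
rewrite inE; apply: (iffP andP) => [[sE /existsP[f /and3P[/injectiveP ? /eqP ? /eqP E]]]|].
  by exists f; split=> //; apply/sub_edgesP; rewrite -E.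
case=> f [inj fadj -> ->]; split; first exact/sub_edgesP.
apply/existsP; exists [ffun i => f i].
have fE : [ffun i => f i] =1 f by move=> i; rewrite ffunE.
apply/and3P; split.
- by apply/injectiveP => i j; rewrite !fE; apply: inj.
- by apply/eqP/eq_imset => i; rewrite fE.
- by apply/eqP/eq_imset => e; apply: eq_imset => i; rewrite fE.
Qed.

Lemma adj_complete r (i j : 'I_r) : adj (complete_graph r) i j = (i != j).
Proof. by rewrite sgraph_ofE andbT. Qed.

Lemma imset_edges_complete r (f : 'I_r -> V) : injective f ->
  [set f @: e | e : {set 'I_r} in edges (complete_graph r)]
  = [set e : {set V} | (e \subset f @: 'I_r) && (#|e| == 2)].
Proof.
move=> inj; apply/setP => e; rewrite inE.
apply/imsetP/andP => [[d /edges_set2[i [j [-> ij]]] ->]|].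
  rewrite imsetU !imset_set1 cards2 (inj_eq inj) -adj_complete ij.
  by rewrite subUset !sub1set !imset_f.
case=> ef /cards2P[u [v [nuv eE]]]; move: ef; rewrite eE subUset !sub1set.
case/andP=> /imsetP[i _ ui] /imsetP[j _ vj].
exists [set i; j]; last by rewrite imsetU !imset_set1 ui vj.
change (adj (complete_graph r) i j); rewrite adj_complete.
by apply: contraNneq nuv => ij; rewrite ui vj ij.
Qed.

(** The edges of a copy are all 2-subsets of its vertex set, so the first projection is injective on
    copies, with image [K4s G]. *)
Lemma card_copies_K4 G : #|copies (complete_graph 4) G| = #|K4s G|.
Proof.
have cl H : H \in copies (complete_graph 4) G ->
    H.1 \in K4s G /\ H.2 = [set e : {set V} | (e \subset H.1) && (#|e| == 2)].
  case/copiesP => f [inj fadj H1 H2].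
  split; last by rewrite H2 H1 imset_edges_complete.
  apply/K4sP; rewrite H1; split; first by rewrite card_imset ?card_ord.
  move=> _ _ /imsetP[i _ ->] /imsetP[j _ ->]; rewrite (inj_eq inj) => nij.
  by apply: fadj; rewrite adj_complete.
rewrite -(@card_in_imset _ _ fst); last first.
  move=> [P E] [P' E'] /cl/= [_ ->] /cl/= [_ ->] ->; by [].
apply: eq_card => Q; apply/imsetP/idP => [[H /cl[HQ _] ->] //|QK].
have /K4sP[Q4 cQ] := QK.
pose f (i : 'I_4) := enum_val (cast_ord (esym Q4) i).
have inj : injective f.
  by move=> i j /enum_val_inj/cast_ord_inj.
have fQ : f @: 'I_4 = Q.
  apply/eqP; rewrite eqEcard card_imset // card_ord Q4 leqnn andbT.
  by apply/subsetP => _ /imsetP[i _ ->]; exact: enum_valP.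
exists (Q, [set f @: e | e : {set 'I_4} in edges (complete_graph 4)]) => //.
apply/copiesP; exists f; split=> // i j; rewrite adj_complete => nij.
by apply: cQ; rewrite ?(inj_eq inj) // -fQ imset_f.
Qed.

Lemma two_cliques_freeP G : is_free (two_cliques 4 1) G <->
  (forall P Q, P \in K4s G -> Q \in K4s G -> #|P :&: Q| <> 1).
Proof.
split=> [free P Q PK QK cPQ|h].
  have /K4sP[P4 cP] := PK; have /K4sP[Q4 cQ] := QK.
  have /cards1P[p ep] : #|P :&: Q| == 1 by rewrite cPQ.
  have /andP[pP pQ] : (p \in P) && (p \in Q) by rewrite -in_setI ep inE.
  (* The common vertex [p] stands at index 3, so indices 0 to 3 enumerate [P] and indices 3 to 6
     enumerate [Q]. *)
  pose s := enum (P :\ p) ++ p :: enum (Q :\ p).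
  have sP : size (enum (P :\ p)) = 3 by rewrite -cardE cardsD1_in // P4.
  have sQ : size (enum (Q :\ p)) = 3 by rewrite -cardE cardsD1_in // Q4.
  have ss : size s = 2 * 4 - 1 by rewrite size_cat /= sP sQ.
  have us : uniq s.
    rewrite cat_uniq cons_uniq !enum_uniq /= !mem_enum !in_setD1 eqxx /= andbT.
    apply/hasPn => u; rewrite !mem_enum !inE => /andP[nup uQ].
    apply/negP => /andP[_ uP]; have : u \in P :&: Q by rewrite inE uP.
    by rewrite ep inE (negbTE nup).
  pose f (i : 'I_(2 * 4 - 1)) := nth p s i.
  have inj : injective f.
    move=> i j /eqP; rewrite /f nth_uniq ?ss //.
    by move/eqP/val_inj.
  have fP (i : 'I_(2 * 4 - 1)) : i < 4 -> f i \in P.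
    rewrite /f nth_cat sP leq_eqVlt ltnS => /orP[/eqP[->]//|lt].
    rewrite lt; have : nth p (enum (P :\ p)) i \in enum (P :\ p) by rewrite mem_nth ?sP.
    by rewrite mem_enum inE => /andP[].
  have fQ (i : 'I_(2 * 4 - 1)) : 3 <= i -> f i \in Q.
    rewrite /f nth_cat sP => le; have -> : (i < 3) = false by rewrite ltnNge le.
    have : nth p (p :: enum (Q :\ p)) (i - 3) \in p :: enum (Q :\ p).
      by rewrite mem_nth //= sQ ltn_subLR //.
    by rewrite inE mem_enum !inE => /orP[/eqP->|/andP[]].
  move/eqP/setP: free => /(_ (f @: 'I_(2 * 4 - 1),
     [set f @: e | e : {set 'I_(2 * 4 - 1)} in edges (two_cliques 4 1)])).
  rewrite in_set0 => /negbT/copiesP; apply; exists f; split=> // i j.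
  rewrite sgraph_ofE => /andP[nij].
  rewrite -(inj_eq inj) in nij.
  by case/orP=> /orP[] /andP[? ?]; [apply: cP|apply: cQ|apply: cP|apply: cQ];
     rewrite ?fP ?fQ.
apply/set0Pn => -[E /copiesP[f [inj fadj _ _]]].
(* The images of the two index ranges are K4s that share only the image of 3. *)
pose L := [set i : 'I_(2 * 4 - 1) | i < 4]; pose H := [set i : 'I_(2 * 4 - 1) | 3 <= i].
apply: (h (f @: L) (f @: H)).
- apply/K4sP; split.
    rewrite card_imset // -sum1dep_card big_mkcond.
    by rewrite !big_ord_recl big_ord0.
  move=> _ _ /imsetP[i + ->] /imsetP[j + ->]; rewrite !inE => iL jL nij.
  apply: fadj; rewrite sgraph_ofE iL jL /= andbT.
  by apply: contraNneq nij => ->.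
- apply/K4sP; split.
    rewrite card_imset // -sum1dep_card big_mkcond.
    by rewrite !big_ord_recl big_ord0.
  move=> _ _ /imsetP[i + ->] /imsetP[j + ->]; rewrite !inE => iH jH nij.
  apply: fadj; rewrite sgraph_ofE iH jH /= orbT andbT.
  by apply: contraNneq nij => ->.
- rewrite -imsetI; last by move=> ? ? _ _; apply: inj.
  rewrite card_imset // -sum1_card big_mkcond !big_ord_recl big_ord0.
  by rewrite /L /H !inE.
Qed.

Lemma K4_family_K4s G : is_free (two_cliques 4 1) G -> K4_family (K4s G).
Proof.
move/two_cliques_freeP => h; split=> // [Q /K4sP[]//|T T4 cT].
apply/K4sP; split=> // u v uT vT nuv.
by have [Q [/K4sP[_ cQ] uQ vQ]] := cT u v uT vT nuv; apply: cQ.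
Qed.

End Graphs.

(** * Isomorphisms and relabelling *)

Lemma iso_adjP (U V : finType) (G : sgraph U) (H : sgraph V) :
  iso G H <-> exists2 f : U -> V, bijective f &
    forall u v, adj H (f u) (f v) = adj G u v.
Proof.
split=> -[f bij_f E]; exists f => //.
  move=> u v; rewrite /adj E; apply/imsetP/idP => [[e eG]|uv].
    rewrite -!imset_set1 -imsetU => /(imset_inj (bij_inj bij_f)) ->; exact: eG.
  by exists [set u; v]; rewrite // imsetU !imset_set1.
have [g fK gK] := bij_f.
apply/setP => e; apply/idP/imsetP => [/edges_set2[p [q [-> pq]]]|].
  exists [set g p; g q]; last by rewrite imsetU !imset_set1 !gK.
  by change (adj G (g p) (g q)); rewrite -E !gK.
by case=> d /edges_set2[u [v [-> uv]]] ->; rewrite imsetU !imset_set1 -/(adj H _ _) E.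
Qed.

Lemma iso_sym (U V : finType) (G : sgraph U) (H : sgraph V) : iso G H -> iso H G.
Proof.
case/iso_adjP => f [g fK gK] E; apply/iso_adjP; exists g; first by exists f.
by move=> u v; rewrite -E !gK.
Qed.

Lemma eq_card_bij (U V : finType) : #|U| = #|V| -> exists f : U -> V, bijective f.
Proof.
move=> e; exists (fun u => enum_val (cast_ord e (enum_rank u))).
exists (fun v => enum_val (cast_ord (esym e) (enum_rank v))) => u.
  by rewrite enum_valK cast_ordK enum_rankK.
by rewrite enum_valK cast_ordKV enum_rankK.
Qed.

(** [ex] ranges over graphs on ['I_n], whereas a join lives on a sum type and has to be
    transported. *)
Lemma relabel (U V : finType) (H : sgraph V) : #|U| = #|V| ->
  exists G : sgraph U, iso G H.
Proof.
case/eq_card_bij => f bij_f; exists (sgraph_of (fun u v => adj H (f u) (f v))).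
apply/iso_adjP; exists f => // u v; rewrite sgraph_ofE [adj H (f v) _]adj_sym orbb.
by case: eqVneq => // ->; apply/negP => /adj_neq; rewrite eqxx.
Qed.

(** * Books over complete bipartite graphs *)

Section Book.
Variable V : finType.
Implicit Types (G : sgraph V) (x y u v a b : V) (N B Q : {set V}).

(** The join of K_2 on the spine [x], [y] with the complete bipartite graph on [N] and [B],
    described inside [V]. Balance of the parts is imposed separately, through [#|N| * #|B|]. *)
Definition bipartite_book G x y N B :=
  [/\ x != y, [set x; y] :|: (N :|: B) = setT,
      [/\ x \notin N :|: B, y \notin N :|: B & N :&: B = set0] &
      forall u v, adj G u v =
        [&& u != v, ~~ ((u \in N) && (v \in N)) & ~~ ((u \in B) && (v \in B))]].

Lemma bipartite_book_sym G x y N B :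
  bipartite_book G x y N B -> bipartite_book G x y B N.
Proof.
case=> nxy UT [xNB yNB NB] E; split=> //; first by rewrite (setUC B).
  by rewrite !(setUC B) setIC.
by move=> u v; rewrite E [~~ _ && ~~ _]andbC.
Qed.

Lemma card_bipartite_book G x y N B :
  bipartite_book G x y N B -> #|N| + #|B| = #|V| - 2.
Proof.
case=> nxy UT [xNB yNB NB] _.
have <- : #|[set x; y] :|: (N :|: B)| = #|V| by rewrite UT cardsT.
have xyNB : x \notin y |: (N :|: B) by rewrite in_setU1 negb_or nxy.
by rewrite -setUA !cardsU1 xyNB yNB cardsU NB cards0 subn0 addnA addKn.
Qed.

(** A K4 has at most two vertices on the spine and one in each part; these bounds sum to 4, so all
    are attained. *)
Lemma K4s_bipartite_book G x y N B : bipartite_book G x y N B ->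
  K4s G = [set [set x; y; a; b] | a in N, b in B].
Proof.
case=> nxy UT [xNB yNB NB0] E.
have notN u : u \in B -> u \notin N.
  by move=> uB; apply: contra_eqN NB0 => uN; apply/set0Pn; exists u; rewrite inE uN.
apply/setP => Q; apply/K4sP/imset2P => [[Q4 cQ]|[a b aN bB ->]].
  have QN : #|Q :&: N| <= 1.
    apply/card_le1_eqP => u v /[!inE]/andP[uQ uN] /andP[vQ vN]; apply/eqP.
    apply: contraT => nuv; have := cQ v u vQ uQ; rewrite E vN uN nuv.
    by move/(_ isT).
  have QB : #|Q :&: B| <= 1.
    apply/card_le1_eqP => u v /[!inE]/andP[uQ uB] /andP[vQ vB]; apply/eqP.
    apply: contraT => nuv; have := cQ v u vQ uQ; rewrite E vB uB nuv.
    by rewrite !andbF => /(_ isT).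
  have Qxy : #|Q :&: [set x; y]| <= 2.
    by apply: leq_trans (subset_leq_card (subsetIr _ _)) _; rewrite cards2 nxy.
  have QE : Q = (Q :&: [set x; y]) :|: ((Q :&: N) :|: (Q :&: B)).
    by rewrite -!setIUr UT setIT.
  have sum4 : 4 <= #|Q :&: [set x; y]| + (#|Q :&: N| + #|Q :&: B|).
    rewrite -Q4 {1}QE; apply: leq_trans (leq_of_leqif (leq_card_setU _ _)) _.
    by rewrite leq_add2l; apply: leq_of_leqif (leq_card_setU _ _).
  have /cards1P[a ea] : #|Q :&: N| == 1 by clear -QN QB Qxy sum4; lia.
  have /cards1P[b eb] : #|Q :&: B| == 1 by clear -QN QB Qxy sum4; lia.
  have exy : Q :&: [set x; y] = [set x; y].
    apply/eqP; rewrite eqEcard subsetIr cards2 nxy.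
    by clear -QN QB Qxy sum4; lia.
  exists a b.
  - by have := set11 a; rewrite -ea inE => /andP[].
  - by have := set11 b; rewrite -eb inE => /andP[].
  - by rewrite QE exy ea eb !setUA.
have nxN : x \notin N by apply: contra xNB; rewrite inE => ->.
have nyN : y \notin N by apply: contra yNB; rewrite inE => ->.
have nxB : x \notin B by apply: contra xNB; rewrite inE => ->; rewrite orbT.
have nyB : y \notin B by apply: contra yNB; rewrite inE => ->; rewrite orbT.
have aB : a \notin B by apply: contraL aN => /notN.
have bN := notN _ bB.
split.
  apply: card_set4; rewrite /= !inE !negb_or nxy /= andbT.
  have nxa : x != a by apply: contraNneq nxN => ->.
  have nxb : x != b by apply: contraNneq nxB => ->.
  have nya : y != a by apply: contraNneq nyN => ->.
  have nyb : y != b by apply: contraNneq nyB => ->.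
  have nab : a != b by apply: contraNneq aB => ->.
  by rewrite nxa nxb nya nyb nab.
move=> u v uQ vQ nuv; rewrite E nuv /=.
have inN w : w \in [set x; y; a; b] -> w \in N -> w = a.
  rewrite !inE -!orbA => /or4P[]/eqP-> //.
  - by rewrite (negbTE nxN).
  - by rewrite (negbTE nyN).
  - by rewrite (negbTE bN).
have inB w : w \in [set x; y; a; b] -> w \in B -> w = b.
  rewrite !inE -!orbA => /or4P[]/eqP-> //.
  - by rewrite (negbTE nxB).
  - by rewrite (negbTE nyB).
  - by rewrite (negbTE aB).
apply/andP; split; apply/negP => /andP[uS vS]; case/eqP: nuv.
  by rewrite (inN u) // (inN v).
by rewrite (inB u) // (inB v).
Qed.

Lemma card_K4s_bipartite_book G x y N B : bipartite_book G x y N B ->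
  #|K4s G| = #|N| * #|B|.
Proof.
move=> bk; rewrite (K4s_bipartite_book bk) curry_imset2X.
case: bk => nxy UT [xNB yNB NB0] E.
rewrite card_in_imset ?cardsX // => -[a b] [a' b'].
rewrite !in_setX /= => /andP[aN bB] /andP[a'N b'B] eQ.
move: xNB yNB; rewrite !inE !negb_or => /andP[xN xB] /andP[yN yB].
have disj u : u \in N -> u \in B -> false.
  by move=> uN uB; rewrite -(in_set0 u) -NB0 inE uN.
have ea : a = a'.
  have : a \in [set x; y; a'; b'] by rewrite -eQ !inE eqxx orbT.
  rewrite !inE -!orbA => /or4P[]/eqP ea //; move: (aN); rewrite ea.
  - by rewrite (negbTE xN).
  - by rewrite (negbTE yN).
  - by move/disj => /(_ b'B).
have eb : b = b'.
  have : b \in [set x; y; a'; b'] by rewrite -eQ !inE eqxx !orbT.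
  rewrite !inE -!orbA => /or4P[]/eqP eb //; move: (bB); rewrite eb.
  - by rewrite (negbTE xB).
  - by rewrite (negbTE yB).
  - by move=> /(disj _ a'N).
by rewrite ea eb.
Qed.

Lemma bipartite_book_free G x y N B : bipartite_book G x y N B ->
  is_free (two_cliques 4 1) G.
Proof.
move=> bk; apply/two_cliques_freeP => P Q.
rewrite (K4s_bipartite_book bk) => /imset2P[a b _ _ ->] /imset2P[c d _ _ ->].
case: bk => nxy _ _ _ cPQ.
have : [set x; y] \subset [set x; y; a; b] :&: [set x; y; c; d].
  by rewrite subUset !sub1set !inE !eqxx !orbT.
by move/subset_leq_card; rewrite cPQ cards2 nxy.
Qed.

(** [max_book] only describes the K4s, from which adjacency is recovered: an edge inside one part
    would form with the spine a K4 missing the other part, and any other pair lies in some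
    [[set x; y; a; b]]. *)
Lemma extremal_bipartite_book G : 45 <= #|V| ->
  is_free (two_cliques 4 1) G -> #|K4s G| = (#|V| - 2) ^ 2 %/ 4 ->
  exists x y N B, bipartite_book G x y N B /\ #|N| * #|B| = (#|V| - 2) ^ 2 %/ 4.
Proof.
move=> n45 free cK; have KF := K4_family_K4s free.
have [|x [y [tw xF]]] := twin_of_large_K4_family KF n45; first by rewrite cK.
have [nxy _ _] := twinP _ _ _ tw.
have [N [B [[xNB yNB NB0 UT] cNB KE]]] := max_book KF tw xF cK.
(* Both parts are nonempty, so every vertex lies in a K4 with the spine. *)
have NBpos : 0 < #|N| * #|B| by rewrite cNB; clear -n45; nia.
move: (NBpos); rewrite muln_gt0 => /andP[/card_gt0P[a0 a0N] /card_gt0P[b0 b0B]].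
exists x, y, N, B; split=> //; split=> // u v.
have [->|nuv] := eqVneq u v; first by apply/negP => /adj_neq; rewrite eqxx.
have cases w : [|| w == x, w == y, w \in N | w \in B].
  by have := in_setT w; rewrite -UT !inE -!orbA.
have disj w : w \in N -> w \in B -> false.
  by move=> wN wB; rewrite -(in_set0 w) -NB0 inE wN.
have clique a b : a \in N -> b \in B -> forall s t, s \in [set x; y; a; b] ->
    t \in [set x; y; a; b] -> s != t -> adj G s t.
  move=> aN bB; have /K4sP[_] : [set x; y; a; b] \in K4s G; last by [].
  by rewrite KE; apply/imset2P; exists a b.
move: (xNB) (yNB); rewrite !inE !negb_or => /andP[xN xB] /andP[yN yB].
(* [S] and [T] stand for the two parts in either order; [c] in [T] serves to join the vertices of
   [S] to the spine. *)
have indep (S T : {set V}) c : c \in T -> x \notin S -> y \notin S ->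
    x \notin T -> y \notin T -> (forall w, w \in S -> w \in T -> false) ->
    (forall s p q, s \in S -> p \in [set x; y; s; c] -> q \in [set x; y; s; c] ->
      p != q -> adj G p q) ->
    (forall Q, Q \in K4s G -> exists2 d, d \in T & d \in Q) ->
    forall s t, s \in S -> t \in S -> ~~ adj G s t.
  move=> cT xS yS xT yT dST cl hT s t sS tS; apply/negP => st; have nst := adj_neq st.
  have : [set x; y; s; t] \in K4s G.
    apply/K4sP; split.
      have [nxs nxt] : x != s /\ x != t by split; apply: contraNneq xS => ->.
      have [nys nyt] : y != s /\ y != t by split; apply: contraNneq yS => ->.
      by apply: card_set4; rewrite /= !inE !negb_or nxy nxs nxt nys nyt nst.
    have cs := cl s _ _ sS; have ct := cl t _ _ tS.
    move=> p q; rewrite !inE -!orbA => /or4P[]/eqP-> /or4P[]/eqP->; rewrite ?eqxx // => nn;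
      first [ by apply: cs; rewrite // !inE eqxx ?orbT
            | by apply: ct; rewrite // !inE eqxx ?orbT
            | by [] | by rewrite adj_sym ].
  case/hT => d dT; rewrite !inE -!orbA => /or4P[]/eqP ed; move: (dT); rewrite ed.
  - by rewrite (negbTE xT).
  - by rewrite (negbTE yT).
  - by move/(dST _ sS).
  - by move/(dST _ tS).
have noN s t : s \in N -> t \in N -> ~~ adj G s t.
  apply: (indep N B b0) => // [{}s p q sN|Q]; first exact: clique.
  by rewrite KE => /imset2P[a b _ bB ->]; exists b; rewrite // !inE eqxx orbT.
have noB s t : s \in B -> t \in B -> ~~ adj G s t.
  apply: (indep B N a0) => // [w wB wN|{}s p q sB|Q]; first exact: disj wN wB.
    by rewrite (setUAC _ [set s]); apply: clique.
  by rewrite KE => /imset2P[a b aN _ ->]; exists a; rewrite // !inE eqxx !orbT.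
have [/andP[uN vN]|nN] := boolP ((u \in N) && (v \in N)); first exact/negbTE/noN.
have [/andP[uB vB]|nB] := boolP ((u \in B) && (v \in B)); first exact/negbTE/noB.
(* [a] and [b] are chosen so that [[set x; y; a; b]] contains [u] and [v], with [a0] and [b0] as
   fillers. *)
rewrite /=; have [a [aN au av]] : exists a, [/\ a \in N, u \in N -> u = a & v \in N -> v = a].
  case uN: (u \in N) nN => /= nN; first by exists u; split=> //; rewrite (negbTE nN).
  case vN: (v \in N); first by exists v.
  by exists a0.
have [b [bB bu bv]] : exists b, [/\ b \in B, u \in B -> u = b & v \in B -> v = b].
  case uB: (u \in B) nB => /= nB; first by exists u; split=> //; rewrite (negbTE nB).
  case vB: (v \in B); first by exists v.
  by exists b0.
apply: (clique a b) => //.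
  by have := cases u; rewrite !inE -!orbA => /or4P[->|->|/au->|/bu->]; rewrite ?eqxx ?orbT.
by have := cases v; rewrite !inE -!orbA => /or4P[->|->|/av->|/bv->]; rewrite ?eqxx ?orbT.
Qed.

End Book.

(** * Identification with the join of K_2 and T_2(m) *)

Lemma card_odd_ord m : #|[set i : 'I_m | odd i]| = m./2.
Proof.
rewrite -sum1dep_card big_mkcond /=; elim: m => [|m IH]; first by rewrite big_ord0.
by rewrite big_ord_recr /= IH uphalf_half addnC; case: (odd m).
Qed.

Lemma card_even_ord m : #|[set i : 'I_m | ~~ odd i]| = uphalf m.
Proof.
have := cardsC [set i : 'I_m | odd i]; rewrite card_odd_ord card_ord.
have -> : ~: [set i : 'I_m | odd i] = [set i : 'I_m | ~~ odd i].
  by apply/setP => i; rewrite !inE.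
by rewrite uphalf_half; have := odd_double_half m; clear; lia.
Qed.

Lemma adj_turan2 m (i j : 'I_m) :
  adj (turan 2 m) i j = (odd i != odd j).
Proof.
rewrite sgraph_ofE !modn2 [odd j == _ :> nat]eq_sym orbb.
have [->|_] := eqVneq i j; first by rewrite !eqxx.
by case: (odd i); case: (odd j).
Qed.

Section Extremal.
Variables (V : finType) (m : nat).
Hypothesis cV : #|V| = m.+2.
Let H := join (complete_graph 2) (turan 2 m).

Lemma adj_joinE p q : adj H p q = (p != q) && match p, q with
  | inr i, inr j => odd i != odd j | _, _ => true end.
Proof.
rewrite sgraph_ofE; case: p q => [i|i] [j|j] //.
- by rewrite !adj_complete [j == i]eq_sym orbb andbb andbT.
- by rewrite ![in X in _ && X]adj_turan2 [odd j == _]eq_sym orbb.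
Qed.

Lemma iso_bipartite_book (G : sgraph V) : iso G H ->
  exists x y N B, bipartite_book G x y N B /\ #|N| * #|B| = m ^ 2 %/ 4.
Proof.
case/iso_adjP => f [g fK gK] E.
pose N := g @: [set inr i | i in [set i : 'I_m | ~~ odd i]].
pose B := g @: [set inr i | i in [set i : 'I_m | odd i]].
have ginj : injective g by apply: can_inj gK.
have inr_inj : injective (@inr 'I_2 'I_m) by move=> i j [].
have inNE u : (u \in N) = (if f u is inr i then ~~ odd i else false).
  rewrite -[in LHS](fK u) (mem_imset _ _ ginj); case: (f u) => i.
    by apply/imsetP => -[].
  by rewrite (mem_imset _ _ inr_inj) inE.
have inBE u : (u \in B) = (if f u is inr i then odd i else false).
  rewrite -[in LHS](fK u) (mem_imset _ _ ginj); case: (f u) => i.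
    by apply/imsetP => -[].
  by rewrite (mem_imset _ _ inr_inj) inE.
have f_eq u p : (u == g p) = (f u == p) by rewrite -[RHS](inj_eq ginj) fK.
exists (g (inl ord0)), (g (inl ord_max)), N, B; split; last first.
  rewrite !card_imset // card_odd_ord card_even_ord uphalf_half.
  by have := odd_double_half m; clear; nia.
split.
- by rewrite (inj_eq ginj).
- apply/setP => u; rewrite !inE !f_eq inNE inBE; case: (f u) => i; last by rewrite orNb.
  by case: i => -[|[|]].
- split; rewrite ?inE ?inNE ?inBE ?gK //.
  by apply/setP => u; rewrite !inE inNE inBE; case: (f u) => // i; rewrite andNb.
- move=> u v; rewrite -E adj_joinE (inj_eq (can_inj fK)) !inNE !inBE.
  case: (f u) => i; case: (f v) => j; rewrite ?andbF //.
  by case: (odd i); case: (odd j).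
Qed.

(** Two part sizes with sum [m] and product [m ^ 2 %/ 4] are balanced, hence are those of the Turán
    graph. *)
Lemma bipartite_book_iso (G : sgraph V) x y N B : bipartite_book G x y N B ->
  #|N| * #|B| = m ^ 2 %/ 4 -> iso G H.
Proof.
(* The larger part has to be matched with the even indices, of which there are [uphalf m]. *)
wlog le_BN : N B / #|B| <= #|N|.
  move=> wl bk cNB; have [|/ltnW] := leqP #|B| #|N|; first by move/wl; apply.
  by move/wl; apply; [apply: bipartite_book_sym|rewrite mulnC].
move=> bk cNB; have cNBs := card_bipartite_book bk.
rewrite cV subn2 /= in cNBs.
have [cN cB] : #|N| = uphalf m /\ #|B| = m./2.
  by rewrite uphalf_half; have := odd_double_half m; clear -cNB cNBs le_BN; nia.
case: bk => nxy UT [xNB yNB NB0] E.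
(* Counting from 0, index [2k] goes to the [k]-th vertex of [N] and [2k + 1] to the [k]-th vertex of
   [B]; the default [x] is never reached. *)
pose g (p : 'I_2 + 'I_m) : V := match p with
  | inl i => if i == ord0 then x else y
  | inr i => nth x (enum (if odd i then B else N)) i./2 end.
have gin (i : 'I_m) : g (inr i) \in (if odd i then B else N).
  rewrite /= -mem_enum mem_nth // -cardE; have := ltn_ord i.
  case oi: (odd i); rewrite ?cN ?cB ?uphalf_half;
  have := odd_double_half m; have := odd_double_half i; rewrite oi; clear; lia.
have disj w : w \in N -> w \in B -> false.
  by move=> wN wB; rewrite -(in_set0 w) -NB0 inE wN.
have ginNB (i : 'I_m) : g (inr i) \in N :|: B.
  by have := gin i; rewrite inE; case: odd => ->; rewrite ?orbT.
have inj : injective g.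
  have inl_inr (i : 'I_2) (j : 'I_m) : g (inl i) <> g (inr j).
    move=> e; have := ginNB j; rewrite -e /=; case: eqP => _.
      by rewrite (negbTE xNB).
    by rewrite (negbTE yNB).
  move=> [i|i] [j|j] e.
  - have [ei|ni] := eqVneq i ord0; have [ej|nj] := eqVneq j ord0.
    + by rewrite ei ej.
    + by move: e nxy; rewrite /= ei eqxx (negbTE nj) => ->; rewrite eqxx.
    + by move: e nxy; rewrite /= ej eqxx (negbTE ni) => ->; rewrite eqxx.
    + case: i ni {e} => -[|[|]] // ? _.
      by case: j nj => -[|[|]] // ? _; congr inl; apply: val_inj.
  - by case: (inl_inr i j).
  - by case: (inl_inr j i).
  - have oij : odd i = odd j.
      have := gin i; have := gin j; rewrite e; case: odd; case: odd => // h1 h2.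
        by have := disj _ h2 h1.
      by have := disj _ h1 h2.
    have szi (k : 'I_m) : k./2 < size (enum (if odd k then B else N)).
      have := ltn_ord k; rewrite -cardE.
      case ok: (odd k); rewrite ?cN ?cB ?uphalf_half;
      have := odd_double_half m; have := odd_double_half k; rewrite ok; clear; lia.
    have szj := szi j; rewrite -oij in szj.
    move: e => /= /eqP; rewrite -oij nth_uniq ?enum_uniq ?szi ?szj // => /eqP hij.
    congr inr; apply: val_inj => /=.
    by rewrite -(odd_double_half i) -(odd_double_half j) oij hij.
apply: iso_sym; apply/iso_adjP; exists g.
  by apply: inj_card_bij => //; rewrite card_sum !card_ord cV.
move=> p q; rewrite adj_joinE E (inj_eq inj).
have inlNB (i : 'I_2) : g (inl i) \notin N :|: B by rewrite /=; case: ifP.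
have inlF (i : 'I_2) : (g (inl i) \in N) = false /\ (g (inl i) \in B) = false.
  by have := inlNB i; rewrite inE negb_or => /andP[/negbTE-> /negbTE->].
have inrE (i : 'I_m) : (g (inr i) \in N) = ~~ odd i /\ (g (inr i) \in B) = odd i.
  have := gin i; case: odd => h; split=> //; apply/negP => h'.
    by have := disj _ h' h.
  by have := disj _ h h'.
case: p q => [i|i] [j|j].
- by have [-> ->] := inlF i.
- by have [-> ->] := inlF i.
- by have [-> ->] := inlF j; rewrite !andbF.
- have [-> ->] := inrE i; have [-> ->] := inrE j.
  by case: (odd i); case: (odd j).
Qed.

End Extremal.

Theorem theorem1p3 (n : nat) (hn : 45 <= n) :
  ex n (complete_graph 4) (two_cliques 4 1) = (n - 2) ^ 2 %/ 4
  /\ forall (V : finType) (G : sgraph V), #|V| = n ->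
       (is_free (two_cliques 4 1) G /\
        #|copies (complete_graph 4) G| = (n - 2) ^ 2 %/ 4)
       <-> iso G (join (complete_graph 2) (turan 2 (n - 2))).
Proof.
have card2 (V : finType) : #|V| = n -> #|V| = (n - 2).+2.
  by move=> ->; rewrite -addn2 subnK // (leq_trans _ hn).
have of_iso (V : finType) (G : sgraph V) : #|V| = n ->
    iso G (join (complete_graph 2) (turan 2 (n - 2))) ->
    is_free (two_cliques 4 1) G /\
    #|copies (complete_graph 4) G| = (n - 2) ^ 2 %/ 4.
  move=> cV /iso_bipartite_book[x [y [N [B [bk cNB]]]]].
  by rewrite card_copies_K4 (card_K4s_bipartite_book bk) (bipartite_book_free bk).
split; last first.
  move=> V G cV; split; last exact: of_iso.
  rewrite card_copies_K4 => -[free cK].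
  have n45 : 45 <= #|V| by rewrite cV.
  have [|x [y [N [B [bk cNB]]]]] := extremal_bipartite_book n45 free.
    by rewrite cV.
  by apply: (bipartite_book_iso (card2 _ cV) bk); rewrite cNB cV.
apply/eqP; rewrite eqn_leq; apply/andP; split.
  apply/bigmax_leqP => G free; rewrite card_copies_K4 leq_divRL // mulnC.
  (* For [n] at least 45 the quadratic term dominates [36 * n] in the maximum. *)
  have := @card_K4_family _ (K4s G) setT (K4_family_K4s free) (fun Q _ => subsetT Q).
  rewrite cardsT card_ord => /leq_trans; apply; rewrite geq_max leqnn andbT.
  by clear -hn; nia.
(* The extremal graph, carried over to ['I_n], attains the bound. *)
have [|G isoG] := @relabel 'I_n _ (join (complete_graph 2) (turan 2 (n - 2))).
  by rewrite card_sum !card_ord subnKC // (leq_trans _ hn).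
have [free <-] := of_iso _ G (card_ord n) isoG.
exact: leq_bigmax_cond.
Qed.
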